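(* For every $n\in\mathbb{N}$ and every stream $s$: $\mathit{le}_n\,s$ if and only if $\mathit{bounded}_n\,\mathcal{R}_s$.
   Context: The statement is to be proved constructively (intuitionistic type theory with inductive and coinductive definitions; no excluded middle, no Markov's principle). A color is one of $R$ (red), $B$ (blue). A stream is an element of the coinductive type whose only constructor forms $c\,s$ from a color $c$ and a stream $s$; streams are considered up to bisimilarity (equivalently, functions $\mathbb{N}\to\{R,B\}$ up to pointwise equality). $s@n$ denotes the color of $s$ at position $n$ (positions start at $0$), and $\mathcal{R}_s=\{n\in\mathbb{N}\mid s@n=R\}$. The relation $\mathit{le}_n\,s$ (''$s$ has fewer than $n$ red positions'') is defined coinductively by the rules: $\mathit{le}_{n+1}\,s$ implies $\mathit{le}_{n+1}\,(B\,s)$; $\mathit{le}_n\,s$ implies $\mathit{le}_{n+1}\,(R\,s)$. There is no rule for $\mathit{le}_0$, so $\mathit{le}_0\,s$ is always false. For a set $A$ (here: decidable sets of natural numbers), the relation $\mathit{bounded}_n\,A$ (''every duplicate-free list over $A$ has length less than $n$'') is defined inductively by the single rule: if $\mathit{bounded}_n\,(A\setminus\{x\})$ for all $x\in A$, then $\mathit{bounded}_{n+1}\,A$. There is no rule for $\mathit{bounded}_0$, so it is always false. *)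

(* Defs.v *)
From Stdlib Require Import Bool Arith Streams.

Inductive color : Set := Red | Blue.

Scheme Equality for color.

(* [le_red n s]: the stream [s] has fewer than [n] red positions. *)
CoInductive le_red : nat -> Stream color -> Prop :=
| le_blue_cons : forall (n : nat) (s : Stream color),
    le_red (S n) s -> le_red (S n) (Cons Blue s)
| le_red_cons : forall (n : nat) (s : Stream color),
    le_red n s -> le_red (S n) (Cons Red s).

(* Decidable sets of natural numbers are represented by their
   characteristic functions. *)
Definition dset : Set := nat -> bool.

Definition mem (x : nat) (A : dset) : Prop := A x = true.

Definition setminus1 (A : dset) (x : nat) : dset :=
  fun y => A y && negb (y =? x).

(* [bounded n A]: every duplicate-free list over [A] has length less
   than [n]. *)
Inductive bounded : nat -> dset -> Prop :=
| bounded_step : forall (n : nat) (A : dset),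
    (forall x : nat, mem x A -> bounded n (setminus1 A x)) ->
    bounded (S n) A.

Definition red_positions (s : Stream color) : dset :=
  fun n => color_beq (Str_nth n s) Red.

(* Main.v *)
(** [bounded n A] transfers along maps that are injective on the smaller set,
    which covers inclusions and shifts by one position.  From [bounded] to
    [le_red], shift the set along with the tail of the stream, removing position
    [0] whenever the head is red.  From [le_red] to [bounded], recoloring a red
    position of [s] in blue lowers the index of [le_red] by one, exactly as
    removing it from the set of red positions lowers the index of [bounded];
    induction on [n] concludes. *)

Require Import Defs.
From Stdlib Require Import Streams Bool Arith.

Lemma mem_setminus1 (A : dset) (x y : nat) :
  mem y (setminus1 A x) <-> mem y A /\ y <> x.
Proof.
  unfold mem, setminus1.
  now rewrite andb_true_iff, negb_true_iff, Nat.eqb_neq.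
Qed.

(** Induction on the derivation for [A]: removing [x] from [B] is matched by removing [f x] from
    [A], and injectivity keeps the rest of [B] away from [f x]. *)
Lemma bounded_inj (n : nat) (A B : dset) (f : nat -> nat) :
  (forall x, mem x B -> mem (f x) A) ->
  (forall x y, mem x B -> mem y B -> f x = f y -> x = y) ->
  bounded n A -> bounded n B.
Proof.
  intros HBA Hinj HA; revert B HBA Hinj.
  induction HA as [n A _ IH]; intros B HBA Hinj.
  constructor; intros x Hx.
  apply (IH (f x) (HBA x Hx)).
  - intros y [Hy Hyx]%mem_setminus1.
    apply mem_setminus1; split; auto.
  - intros y z [Hy _]%mem_setminus1 [Hz _]%mem_setminus1; auto.
Qed.

Lemma bounded_subset (n : nat) (A B : dset) :
  (forall x, mem x B -> mem x A) -> bounded n A -> bounded n B.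
Proof. intros HBA; apply (bounded_inj n A B (fun x => x)); auto. Qed.

Lemma bounded_shift (n : nat) (A B : dset) :
  (forall x, mem x B -> mem (S x) A) -> bounded n A -> bounded n B.
Proof. intros HBA; apply (bounded_inj n A B S); auto. Qed.

Lemma bounded_le_red :
  forall (n : nat) (s : Stream color), bounded n (red_positions s) -> le_red n s.
Proof.
  cofix CH; intros n s Hs.
  destruct n as [|n]; [inversion Hs|].
  destruct s as [[|] s].
  - apply le_red_cons, CH.
    inversion Hs as [m A Hrem]; subst.
    (* [eq_refl] shows that position [0] is red; the shift [S] never hits it. *)
    apply (bounded_shift _ _ _) with (2 := Hrem 0 eq_refl).
    intros x Hx; apply mem_setminus1; split; [exact Hx | discriminate].
  - apply le_blue_cons, CH.
    apply (bounded_shift _ _ _) with (2 := Hs).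
    intros x Hx; exact Hx.
Qed.

Fixpoint recolor_blue (x : nat) (s : Stream color) : Stream color :=
  match x, s with
  | 0, Cons _ t => Cons Blue t
  | S y, Cons c t => Cons c (recolor_blue y t)
  end.

Lemma mem_recolor_blue (x y : nat) (s : Stream color) :
  mem y (red_positions s) -> y <> x ->
  mem y (red_positions (recolor_blue x s)).
Proof.
  revert y s; induction x as [|x IH]; intros [|y] [c s] Hy Hyx;
    try exact Hy; try easy.
  apply (IH y s); [exact Hy | congruence].
Qed.

Lemma le_red_blue (n : nat) (s : Stream color) :
  le_red n s -> le_red n (Cons Blue s).
Proof.
  destruct n as [|n]; intros Hs; [inversion Hs | now constructor].
Qed.

(** The recolored cell lies at finite depth, so induction on [x] suffices: the [le_red_cons] used
    there becomes a blue step that keeps the index of the tail. *)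
Lemma le_red_recolor_blue (x n : nat) (s : Stream color) :
  mem x (red_positions s) -> le_red (S n) s -> le_red n (recolor_blue x s).
Proof.
  revert n s; induction x as [|x IH]; intros n [c s] Hx Hs;
    inversion Hs as [m t Ht | m t Ht]; subst; simpl.
  - discriminate Hx.
  - now apply le_red_blue.
  - now apply le_red_blue, IH.
  (* [le_red 0] is empty, so the index of the tail is a successor, as [le_red_cons] requires. *)
  - destruct n as [|n]; [inversion Ht |].
    now apply le_red_cons, IH.
Qed.

Lemma le_red_bounded (n : nat) (s : Stream color) :
  le_red n s -> bounded n (red_positions s).
Proof.
  revert s; induction n as [|n IH]; intros s Hs; [inversion Hs |].
  constructor; intros x Hx.
  apply (bounded_subset n (red_positions (recolor_blue x s))).
  - intros y [Hy Hyx]%mem_setminus1; now apply mem_recolor_blue.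
  - now apply IH, le_red_recolor_blue.
Qed.

Theorem lemma5p2 (n : nat) (s : Stream color) :
  le_red n s <-> bounded n (red_positions s).
Proof.
  split; [apply le_red_bounded | apply bounded_le_red].
Qed.
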